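(* Let $d\ge1$, let $\Pi$ be a translation-invariant simple point process on $\mathbb{R}^d$ with intensity $\lambda\in(0,\infty)$ which is ergodic under translations, let $\alpha\in(0,\infty)$, and let $\Psi=\Psi_\Pi$ be a stable factor allocation to $[\Pi]$ with appetite $\alpha$. (i) If $\lambda\alpha<1$, then a.s. all centers are sated but there is an infinite volume of unclaimed sites. (ii) If $\lambda\alpha=1$, then a.s. all centers are sated and $\mathcal{L}$-almost all sites are claimed. (iii) If $\lambda\alpha>1$, then a.s. not all centers are sated but $\mathcal{L}$-almost all sites are claimed.
   Context: $|\cdot|$ is the Euclidean norm and $\mathcal{L}$ is Lebesgue measure (volume) on $\mathbb{R}^d$. Elements of $\mathbb{R}^d$ are called sites. Let $\Xi\subset\mathbb{R}^d$ be discrete (every bounded subset of $\mathbb{R}^d$ contains only finitely many of its elements); elements of $\Xi$ are called centers. An allocation of $\mathbb{R}^d$ to $\Xi$ with appetite $\alpha$ is a measurable function $\psi:\mathbb{R}^d\to\Xi\cup\{\infty,\Delta\}$ (where $\infty,\Delta$ are two extra symbols) such that $\mathcal{L}[\psi^{-1}(\Delta)]=0$ and $\mathcal{L}[\psi^{-1}(\xi)]\le\alpha$ for all $\xi\in\Xi$. The set $\psi^{-1}(\xi)$ is the territory of $\xi$. A center $\xi$ is sated if $\mathcal{L}[\psi^{-1}(\xi)]=\alpha$ and unsated otherwise. A site $x$ is claimed if $\psi(x)\in\Xi$ and unclaimed if $\psi(x)=\infty$. Stability: let $\xi$ be a center and $x$ a site with $\psi(x)\notin\{\xi,\Delta\}$.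 We say $x$ desires $\xi$ if $|x-\xi|<|x-\psi(x)|$ or $x$ is unclaimed. We say $\xi$ covets $x$ if $|x-\xi|<|x'-\xi|$ for some $x'\in\psi^{-1}(\xi)$, or $\xi$ is unsated. The pair $(x,\xi)$ is unstable for $\psi$ if $x$ desires $\xi$ and $\xi$ covets $x$. An allocation is stable if there are no unstable pairs. Point processes: $\Pi$ has law $\mathbf{P}$. For a simple point measure $\pi$, $[\pi]=\{z\in\mathbb{R}^d:\pi(\{z\})=1\}$ is its support; the centers are $\Xi=[\Pi]$, which is a.s. discrete since the intensity (mean number of points per unit volume) is finite. A factor allocation is a measurable map $\Psi_\bullet$ (meaning $(\pi,x)\mapsto\Psi_\pi(x)$ is measurable) assigning to $\mathbf{P}$-a.e. point measure $\pi$ an allocation $\Psi_\pi$ to $[\pi]$, which is translation-equivariant: for every translation $T$ of $\mathbb{R}^d$, if $\Psi_\pi(x)=\xi$ then $\Psi_{T\pi}(Tx)=T\xi$ (with $T\infty=\infty$, $T\Delta=\Delta$, and with $\Psi_{T\pi}$ defined if and only if $\Psi_\pi$ is). A stable factor allocation is a factor allocation such that $\Psi_\Pi$ is a.s. stable; such an allocation exists and $\Psi_\Pi$ is a.s. $\mathcal{L}$-a.e. unique. *)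

(* Defs.v *)
From HB Require Import structures.
From mathcomp Require Import all_boot all_order all_algebra.
From mathcomp Require Import all_classical all_reals all_analysis.
From mathcomp Require Import measurable_realfun.

Set Implicit Arguments.
Unset Strict Implicit.
Unset Printing Implicit Defensive.

Import Order.TTheory GRing.Theory Num.Theory.
Import numFieldNormedType.Exports.

Local Open Scope classical_set_scope.
Local Open Scope ring_scope.
Local Open Scope ereal_scope.

(* Borel structure of R^n, generated by the coordinate maps, as for
   n.-tuple in mathcomp-analysis. *)
Definition rV_display : measure_display.
Proof. by constructor. Qed.

Section measurable_rV.
Context (R : realType) (n : nat).

Let coords : 'I_n -> 'rV[R]_n -> R := fun i x => x ord0 i.

Let rV_measurable0 : g_sigma_preimage coords set0.
Proof. exact: sigma_algebra0. Qed.

Let rV_measurableC A : g_sigma_preimage coords A ->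
  g_sigma_preimage coords (~` A).
Proof. exact: sigma_algebraC. Qed.

Let rV_measurableU (F : _^nat) : (forall i, g_sigma_preimage coords (F i)) ->
  g_sigma_preimage coords (\bigcup_i (F i)).
Proof. exact: sigma_algebra_bigcup. Qed.

HB.instance Definition _ := @isMeasurable.Build rV_display
  'rV[R]_n (g_sigma_preimage coords)
  rV_measurable0 rV_measurableC rV_measurableU.

Lemma measurable_coord (i : 'I_n) :
  measurable_fun [set: 'rV[R]_n] (fun x : 'rV[R]_n => x ord0 i).
Proof.
move=> _ Y mY; rewrite setTI; apply: sub_sigma_algebra => /=.
rewrite -bigcup_seq/=; exists i => /=; first by rewrite mem_index_enum.
by exists Y => //; rewrite setTI.
Qed.

Lemma measurable_fun_rVP d (T : measurableType d) (f : T -> 'rV[R]_n) :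
  measurable_fun [set: T] f <->
  forall i, measurable_fun [set: T] (fun t => f t ord0 i).
Proof.
split=> [mf i|mf].
  exact: (measurableT_comp (measurable_coord i) mf).
apply: (@measurability _ _ _ _ setT f
  (\big[setU/set0]_(i < n) preimage_set_system setT (coords i) measurable)) => //.
move=> _ [B + <-].
rewrite -bigcup_seq => -[i _ [C mC <-]]; rewrite setTI setTI.
by have := mf i measurableT _ mC; rewrite setTI.
Qed.

End measurable_rV.

Section vector_cons.
Context (R : realType) (n : nat).

Definition rV_cons (p : measurableTypeR R * 'rV[R]_n) : 'rV[R]_n.+1 :=
  \row_(i < n.+1) oapp (fun j : 'I_n => p.2 ord0 j) p.1 (unlift ord0 i).

Lemma measurable_rV_cons : measurable_fun setT rV_cons.
Proof.
apply/measurable_fun_rVP => i; case: (unliftP ord0 i) => [j|] ->.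
- under eq_fun do rewrite mxE liftK /=.
  exact: (measurableT_comp (measurable_coord j) measurable_snd).
- under eq_fun do rewrite mxE unlift_none /=.
  exact: measurable_fst.
Qed.

Definition rV_uncons (x : 'rV[R]_n.+1) : measurableTypeR R * 'rV[R]_n :=
  (x ord0 ord0, \row_(j < n) x ord0 (lift ord0 j)).

Lemma measurable_rV_uncons : measurable_fun setT rV_uncons.
Proof.
apply/measurable_fun_pairP; split; first exact: measurable_coord.
apply/measurable_fun_rVP => j.
by under eq_fun do rewrite /= mxE; exact: measurable_coord.
Qed.

Lemma rV_consK : cancel rV_cons rV_uncons.
Proof.
move=> [a v]; rewrite /rV_uncons mxE unlift_none /=; congr pair.
by apply/rowP => j; rewrite !mxE liftK.
Qed.

Lemma rV_unconsK : cancel rV_uncons rV_cons.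
Proof.
move=> x; apply/rowP => i; rewrite mxE.
by case: unliftP => [j|] -> //=; rewrite mxE.
Qed.

End vector_cons.

Section vector_cons_measure.
Context (R : realType) (n : nat).
Variable mu : {sigma_finite_measure set 'rV[R]_n -> \bar R}.

Definition rV_cons_measure : set 'rV[R]_n.+1 -> \bar R :=
  pushforward (@lebesgue_measure R \x mu) (@rV_cons R n).

Let rV_cons_measure0 : rV_cons_measure set0 = 0.
Proof. by rewrite /rV_cons_measure /pushforward preimage_set0 measure0. Qed.

Let rV_cons_measure_ge0 A : 0 <= rV_cons_measure A.
Proof. by rewrite /rV_cons_measure /pushforward measure_ge0. Qed.

Let rV_cons_measure_sigma_additive : semi_sigma_additive rV_cons_measure.
Proof.
have mc B : measurable B -> measurable (@rV_cons R n @^-1` B).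
  by move=> mB; rewrite -[X in measurable X]setTI; exact: measurable_rV_cons.
move=> F mF tF mUF; rewrite /rV_cons_measure /pushforward preimage_bigcup.
apply: measure_semi_sigma_additive => [k||]; first exact: mc.
- apply/trivIsetP => i j _ _ ij; rewrite -preimage_setI.
  by move/trivIsetP : tF => /(_ _ _ _ _ ij) ->//; rewrite preimage_set0.
- by rewrite -preimage_bigcup; exact: mc.
Qed.

HB.instance Definition _ := isMeasure.Build _ _ _ rV_cons_measure
  rV_cons_measure0 rV_cons_measure_ge0 rV_cons_measure_sigma_additive.

Let rV_cons_measure_sigma_finite : sigma_finite setT rV_cons_measure.
Proof.
have /sigma_finiteP[F [TF ndF Foo]] := sigma_finiteT (@lebesgue_measure R).
have /sigma_finiteP[G [TG ndG Goo]] := sigma_finiteT mu.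
exists (fun k => @rV_uncons R n @^-1` (F k `*` G k)).
  rewrite -preimage_bigcup (_ : \bigcup_i _ = setT) ?preimage_setT//.
  rewrite -subTset => -[x y] _.
  have [i _ Fx] : (\bigcup_i F i) x by rewrite -TF.
  have [j _ Gy] : (\bigcup_i G i) y by rewrite -TG.
  exists (maxn i j) => //; split => /=.
    by move: x Fx; exact/subsetPset/ndF/leq_maxl.
  by move: y Gy; exact/subsetPset/ndG/leq_maxr.
move=> k; have [mF Fk] := Foo k; have [mG Gk] := Goo k; split.
  rewrite -[X in measurable X]setTI; apply: measurable_rV_uncons => //.
  exact: measurableX.
rewrite /rV_cons_measure /pushforward -comp_preimage.
rewrite (_ : _ \o _ = id); last by apply/funext => p /=; rewrite rV_consK.
by rewrite preimage_id product_measure1E// lte_mul_pinfty// ge0_fin_numE.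
Qed.

HB.instance Definition _ := Measure_isSigmaFinite.Build _ _ _ rV_cons_measure
  rV_cons_measure_sigma_finite.

End vector_cons_measure.

(* Lebesgue measure on R^n, as the n-fold product of lebesgue_measure. *)
Fixpoint lebesgue_rV (R : realType) (n : nat) :
    {sigma_finite_measure set 'rV[R]_n -> \bar R} :=
  match n with
  | 0%N => \d_(0%R : 'rV[R]_0)
  | m.+1 => rV_cons_measure (lebesgue_rV R m)
  end.

Definition box (R : realType) (n : nat) (a b : 'I_n -> R) : set 'rV[R]_n :=
  [set x | forall i, x ord0 i \in `[a i, b i[].

Lemma lebesgue_rV_box (R : realType) (n : nat) (a b : 'I_n -> R) :
  (forall i, (a i <= b i)%R) ->
  lebesgue_rV R n (box a b) = (\prod_(i < n) (b i - a i))%:E.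
Proof.
elim: n a b => [|n IHn] a b ab.
  rewrite big_ord0 /= diracE mem_set//; by case.
rewrite big_ord_recl /= /rV_cons_measure /pushforward.
rewrite (_ : _ @^-1` _ = `[a ord0, b ord0[%classic `*`
    box (a \o lift ord0) (b \o lift ord0)); last first.
  apply/seteqP; split=> -[x v] /=.
    move=> h; split=> [|i]; first by have := h ord0; rewrite mxE unlift_none.
    by have := h (lift ord0 i); rewrite mxE liftK.
  by move=> [h1 h2] i; rewrite mxE; case: unliftP => [j|] ->//; exact: h2.
rewrite product_measure1E//; last first.
  rewrite [X in measurable X](_ : _ = \bigcap_(i in [set: 'I_n])
     ((fun x : 'rV[R]_n => x ord0 i) @^-1`
       `[a (lift ord0 i), b (lift ord0 i)[%classic)); last first.
    by apply/seteqP; split => x /= h i; [move=> _; exact: h|exact: h].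
  apply: fin_bigcap_measurable => // i _.
  by rewrite -[X in measurable X]setTI; exact: measurable_coord.
rewrite [X in _ * X]IHn; last by move=> i; exact: ab.
rewrite [X in X * _](_ : _ = (b ord0 - a ord0)%:E) -?EFinM//.
apply: etrans (lebesgue_measure_itv `[a ord0, b ord0[) _.
rewrite /= lte_fin; case: ltP => // ba.
have -> : a ord0 = b ord0 by apply/eqP; rewrite eq_le ab ba.
by rewrite subrr.
Qed.

(* The norm `|x| of 'rV[R]_d in mathcomp-analysis is the sup norm; distances
   below are Euclidean. *)
Definition enorm (R : realType) (d : nat) (x : 'rV[R]_d) : R :=
  Num.sqrt (\sum_(i < d) x ord0 i ^+ 2)%R.

Definition edist (R : realType) (d : nat) (x y : 'rV[R]_d) : R :=
  enorm (x - y)%R.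

Section translation.
Context (R : realType) (d : nat).
Implicit Types v x : 'rV[R]_d.

Lemma measurable_shift v : measurable_fun setT (shift v).
Proof.
apply/measurable_fun_rVP => i; under eq_fun do rewrite /= mxE.
by apply: measurable_funD => //; exact: measurable_coord.
Qed.

Lemma measurable_rV_set1 x : measurable [set x].
Proof.
rewrite (_ : [set x] = \bigcap_(i in [set: 'I_d])
    ((fun y : 'rV[R]_d => y ord0 i) @^-1` [set x ord0 i])).
  apply: fin_bigcap_measurable => // i _.
  by rewrite -[X in measurable X]setTI; exact: measurable_coord.
apply/seteqP; split=> [y -> i //|y h].
by apply/rowP => i; exact: (h i I).
Qed.

End translation.

(* Locally finite integer-valued Borel measures without multiple points. *)
Section point_measure.
Context (R : realType) (d : nat).

Definition is_simple_point_measure (m : set 'rV[R]_d -> \bar R) :=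
  (forall A : set 'rV[R]_d, measurable A -> bounded_set A ->
     exists k : nat, m A = (k%:R)%:E) /\
  (forall z, m [set z] <= 1).

Record point_measure := PointMeasure {
  pm_measure :> {measure set 'rV[R]_d -> \bar R} ;
  pm_simple : is_simple_point_measure pm_measure }.

Lemma mzero_is_simple_point_measure :
  is_simple_point_measure (@mzero _ 'rV[R]_d R).
Proof.
by split=> [A _ _|z]; rewrite /mzero ?lee01//; exists 0%N.
Qed.

HB.instance Definition _ := gen_eqMixin point_measure.
HB.instance Definition _ := gen_choiceMixin point_measure.
HB.instance Definition _ := isPointed.Build point_measure
  (PointMeasure mzero_is_simple_point_measure).

Definition pm_ev (A : set 'rV[R]_d) (p : point_measure) : \bar R := p A.

Definition pm_measurable : set (set point_measure) :=
  <<s \bigcup_(A in measurable)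
        preimage_set_system [set: point_measure] (pm_ev A) measurable >>.

Let pm_measurable0 : pm_measurable set0.
Proof. exact: sigma_algebra0. Qed.

Let pm_measurableC (U : set point_measure) :
  pm_measurable U -> pm_measurable (~` U).
Proof. exact: sigma_algebraC. Qed.

Let pm_measurableU (F : (set point_measure)^nat) :
  (forall i, pm_measurable (F i)) -> pm_measurable (\bigcup_i F i).
Proof. exact: sigma_algebra_bigcup. Qed.

Definition pm_display : measure_display.
Proof. by constructor. Qed.

HB.instance Definition _ := @isMeasurable.Build pm_display point_measure
  pm_measurable pm_measurable0 pm_measurableC pm_measurableU.

Definition pm_support (p : point_measure) : set 'rV[R]_d :=
  [set z | p [set z] = 1].

Section translate.
Variables (v : 'rV[R]_d) (p : point_measure).

Definition pm_pushforward : set 'rV[R]_d -> \bar R := pushforward p (shift v).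

Let mshift A : measurable A -> measurable (shift v @^-1` A).
Proof.
by move=> mA; rewrite -[X in measurable X]setTI; exact: measurable_shift.
Qed.

Let pm_pushforward0 : pm_pushforward set0 = 0.
Proof. by rewrite /pm_pushforward /pushforward preimage_set0 measure0. Qed.

Let pm_pushforward_ge0 A : 0 <= pm_pushforward A.
Proof. by rewrite /pm_pushforward /pushforward measure_ge0. Qed.

Let pm_pushforward_sigma_additive : semi_sigma_additive pm_pushforward.
Proof.
move=> F mF tF mUF; rewrite /pm_pushforward /pushforward preimage_bigcup.
apply: measure_semi_sigma_additive => [k||]; first exact: mshift.
- apply/trivIsetP => i j _ _ ij; rewrite -preimage_setI.
  by move/trivIsetP : tF => /(_ _ _ _ _ ij) ->//; rewrite preimage_set0.
- by rewrite -preimage_bigcup; exact: mshift.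
Qed.

HB.instance Definition _ := isMeasure.Build _ _ _ pm_pushforward
  pm_pushforward0 pm_pushforward_ge0 pm_pushforward_sigma_additive.

Lemma pm_pushforward_simple : is_simple_point_measure pm_pushforward.
Proof.
have [pN p1] := pm_simple p; split=> [A mA bA|z].
  apply: pN; first exact: mshift.
  have [M [Mreal MA]] := bA; exists (M + `|v|)%R; split; first exact: num_real.
  move=> N MN x /= Ax.
  have := MA (N - `|v|)%R; rewrite ltrBrDr => /(_ MN _ Ax).
  rewrite /= lerBrDr; apply: le_trans.
  by rewrite -{1}(addrK v x) (le_trans (ler_normB _ _)).
rewrite /pm_pushforward /pushforward (_ : _ @^-1` _ = [set z - v]%R)//.
by apply/seteqP; split=> x /= => [<-|->]; rewrite ?addrK ?subrK.
Qed.

Definition translate : point_measure := PointMeasure pm_pushforward_simple.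

End translate.
End point_measure.

Section point_process.
Context (R : realType) (d : nat).
Variable P : set (point_measure R d) -> \bar R.

Definition translation_invariant := forall (v : 'rV[R]_d) A,
  measurable A -> P (translate v @^-1` A) = P A.

Definition ergodic := forall A, measurable A ->
  (forall v : 'rV[R]_d, translate v @^-1` A = A) -> P A = 0 \/ P A = 1.

(* Mean number of points in [0, 1[^d, that is, per unit volume under
   translation invariance. *)
Definition intensity : \bar R :=
  \int[P]_p p (box (fun=> 0%R) (fun=> 1%R)).

End point_process.

(* The disjoint union of R^d and of the two symbols ∞ and Δ. *)
Inductive alloc_value (R : realType) (d : nat) : Type :=
  | Center of 'rV[R]_d
  | Infty
  | Delta.
Arguments Infty {R d}.
Arguments Delta {R d}.

Section alloc_value.
Context (R : realType) (d : nat).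

HB.instance Definition _ := gen_eqMixin (alloc_value R d).
HB.instance Definition _ := gen_choiceMixin (alloc_value R d).
HB.instance Definition _ := isPointed.Build (alloc_value R d) Infty.

(* Disjoint union sigma-algebra: {∞} and {Δ} are measurable. *)
Definition alloc_value_measurable : set (set (alloc_value R d)) :=
  [set A | measurable (@Center R d @^-1` A)].

Let alloc_value_measurable0 : alloc_value_measurable set0.
Proof. by rewrite /alloc_value_measurable /= preimage_set0. Qed.

Let alloc_value_measurableC A :
  alloc_value_measurable A -> alloc_value_measurable (~` A).
Proof. by move=> mA; apply: measurableC. Qed.

Let alloc_value_measurableU (F : (set (alloc_value R d))^nat) :
  (forall i, alloc_value_measurable (F i)) ->
  alloc_value_measurable (\bigcup_i F i).
Proof.
move=> mF; rewrite /alloc_value_measurable /= preimage_bigcup.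
exact: bigcupT_measurable.
Qed.

Definition alloc_value_display : measure_display.
Proof. by constructor. Qed.

HB.instance Definition _ := @isMeasurable.Build alloc_value_display
  (alloc_value R d) alloc_value_measurable
  alloc_value_measurable0 alloc_value_measurableC alloc_value_measurableU.

Definition shift_value (v : 'rV[R]_d) (y : alloc_value R d) : alloc_value R d :=
  match y with
  | Center z => Center (shift v z)
  | Infty => Infty
  | Delta => Delta
  end.

End alloc_value.

Section allocation.
Context (R : realType) (d : nat).
Variables (Xi : set 'rV[R]_d) (alpha : R) (psi : 'rV[R]_d -> alloc_value R d).

Definition territory (xi : 'rV[R]_d) : set 'rV[R]_d :=
  psi @^-1` [set Center xi].

Definition unclaimed_sites : set 'rV[R]_d := psi @^-1` [set Infty].

Definition claimed (x : 'rV[R]_d) := exists2 xi, Xi xi & psi x = Center xi.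

Definition sated (xi : 'rV[R]_d) :=
  lebesgue_rV R d (territory xi) = alpha%:E.

Definition allocation :=
  [/\ measurable_fun setT psi,
      forall x xi, psi x = Center xi -> Xi xi,
      lebesgue_rV R d (psi @^-1` [set Delta]) = 0 &
      forall xi, Xi xi -> lebesgue_rV R d (territory xi) <= alpha%:E].

Definition desires (x xi : 'rV[R]_d) :=
  (exists2 z, psi x = Center z & (edist x xi < edist x z)%R) \/ psi x = Infty.

Definition covets (xi x : 'rV[R]_d) :=
  (exists2 x', territory xi x' & (edist x xi < edist x' xi)%R) \/ ~ sated xi.

Definition unstable_pair (x xi : 'rV[R]_d) :=
  [/\ Xi xi, psi x <> Center xi, psi x <> Delta, desires x xi & covets xi x].

Definition stable := forall x xi, ~ unstable_pair x xi.

End allocation.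

(* A map Psi defined on the set D of point measures; its values outside D are
   irrelevant.  Measurability of D is part of the joint measurability of the
   partial map (p, x) |-> Psi p x. *)
Record factor_allocation (R : realType) (d : nat)
    (P : set (point_measure R d) -> \bar R) (alpha : R)
    (D : set (point_measure R d))
    (Psi : point_measure R d -> 'rV[R]_d -> alloc_value R d) : Prop := {
  fa_measurable_dom : measurable D ;
  fa_ae_dom : {ae P, forall p, D p} ;
  fa_measurable : measurable_fun (D `*` [set: 'rV[R]_d])
    (fun px : point_measure R d * 'rV[R]_d => Psi px.1 px.2) ;
  fa_allocation : forall p, D p -> allocation (pm_support p) alpha (Psi p) ;
  fa_translate_dom : forall v p, D (translate v p) <-> D p ;
  fa_equivariant : forall v p x, D p ->
    Psi (translate v p) (shift v x) = shift_value v (Psi p x) }.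

Definition stable_factor_allocation (R : realType) (d : nat)
    (dO : measure_display) (Omega : measurableType dO)
    (Pr : probability Omega R) (Pi : {mfun Omega >-> point_measure R d})
    (alpha : R) (D : set (point_measure R d))
    (Psi : point_measure R d -> 'rV[R]_d -> alloc_value R d) : Prop :=
  factor_allocation (distribution Pr Pi) alpha D Psi /\
  {ae Pr, forall w, stable (pm_support (Pi w)) alpha (Psi (Pi w))}.

(* Main.v *)
(** Let Q be the unit cube.  The mass transport principle (cut R^d into the
    integer translates of Q and use stationarity of P \x Lebesgue under
    diagonal translations) shows that the mean volume m of the claimed sites in
    Q equals the mean total volume of the territories of the centers in Q.
    Hence m <= lambda * alpha, with equality iff almost surely all centers are
    sated, while m + u = 1 where u is the mean volume of unclaimed sites in Q.
    By stability, an unclaimed site and an unsated center cannot coexist, and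
    by ergodicity "all centers are sated" and "the unclaimed sites have positive
    volume" have probability 0 or 1; comparing m with 1 decides which of them
    holds.  When u > 0 the mean total unclaimed volume is a sum of infinitely
    many copies of u, so that the unclaimed volume, a constant by ergodicity, is
    infinite. *)

Require Import Defs.
From mathcomp Require Import all_boot all_order all_algebra finmap.
From mathcomp Require Import all_classical all_reals all_analysis.
From mathcomp Require Import measurable_realfun.

Set Implicit Arguments.
Unset Strict Implicit.
Unset Printing Implicit Defensive.

Import Order.TTheory GRing.Theory Num.Theory.
Local Open Scope classical_set_scope.
Local Open Scope ring_scope.
Local Open Scope ereal_scope.

(** * Translation invariance *)

Lemma measurable_preimage d1 d2 (T1 : measurableType d1)
    (T2 : measurableType d2) (f : T1 -> T2) (A : set T2) :
  measurable_fun setT f -> measurable A -> measurable (f @^-1` A).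
Proof. by move=> mf mA; rewrite -[_ @^-1` _]setTI; exact: mf. Qed.

Lemma ge0_integral_comp_invariant d (T : measurableType d) (R : realType)
    (mu : {measure set T -> \bar R}) (f : T -> T) (h : T -> \bar R) :
  measurable_fun setT f ->
  (forall A, measurable A -> mu (f @^-1` A) = mu A) ->
  measurable_fun setT h -> (forall x, 0 <= h x) ->
  \int[mu]_x h (f x) = \int[mu]_x h x.
Proof.
move=> mf fmu mh h0.
transitivity (\int[pushforward mu f]_x h x).
  by rewrite (ge0_integral_pushforward mf).
by apply: eq_measure_integral => A mA _; exact: fmu.
Qed.

(** Fibrewise: invariance of [m2] removes [f2] from the measure of each section, then invariance of
    [m1] removes [f1] from the outer integral. *)
Lemma product_measure1_invariant d1 d2 (T1 : measurableType d1)
    (T2 : measurableType d2) (R : realType)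
    (m1 : {measure set T1 -> \bar R})
    (m2 : {sigma_finite_measure set T2 -> \bar R})
    (f1 : T1 -> T1) (f2 : T2 -> T2) (A : set (T1 * T2)) :
  measurable_fun setT f1 ->
  (forall B, measurable B -> m1 (f1 @^-1` B) = m1 B) ->
  (forall B, measurable B -> m2 (f2 @^-1` B) = m2 B) ->
  measurable A ->
  (m1 \x m2) ((fun x => (f1 x.1, f2 x.2)) @^-1` A) = (m1 \x m2) A.
Proof.
move=> mf1 if1 if2 mA; rewrite /product_measure1 /=.
transitivity (\int[m1]_x (m2 \o xsection A) (f1 x)); last first.
  by apply: ge0_integral_comp_invariant => //; exact: measurable_fun_xsection.
apply: eq_integral => x _ /=.
rewrite -[RHS]if2; last exact: measurable_xsection.
by congr (m2 _); apply/seteqP; split => y /=; rewrite /xsection /= !inE.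
Qed.

(** The pushforward under the shift agrees with Lebesgue measure on half-open intervals, which
    determine it. *)
Lemma lebesgue_measure_shift (R : realType) (a : R) (A : set R) :
  measurable (A : set (measurableTypeR R)) ->
  lebesgue_measure ((fun x => (x + a)%R) @^-1` A) = lebesgue_measure A.
Proof.
have mf : measurable_fun setT
    (fun x : measurableTypeR R => (x + a)%R : measurableTypeR R).
  by apply: measurable_funD => //; exact: measurable_cst.
move=> mA; apply/esym.
apply: (@lebesgue_measure_unique R (pushforward lebesgue_measure
  (fun x : measurableTypeR R => (x + a)%R : measurableTypeR R))) => //.
move=> _ [[u v]] _ <-; rewrite /pushforward /=.
rewrite [X in _ = lebesgue_measure X](_ : _ = `]u - a, v - a]%classic)%R.
  rewrite !lebesgue_measure_itv /= !lte_fin ltrD2r.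
  by case: ifP => // _; rewrite -!EFinB; congr EFin; rewrite opprB addrA subrK.
by apply/seteqP; split => x /=; rewrite !in_itv/= ltrBlDr lerBrDr.
Qed.

(** Induction on the dimension: through [rV_cons] the shift splits into a shift of the first
    coordinate and one of the remaining coordinates. *)
Lemma lebesgue_rV_shift (R : realType) (n : nat) (v : 'rV[R]_n)
    (A : set 'rV[R]_n) : measurable A ->
  lebesgue_rV R n (shift v @^-1` A) = lebesgue_rV R n A.
Proof.
elim: n v A => [|n IHn] v A mA.
  by congr (lebesgue_rV R 0 _); apply/seteqP; split => x /=;
    rewrite (_ : x + v = x)%R//; apply/rowP => -[].
rewrite /= /rV_cons_measure /pushforward.
have mA' : measurable (@rV_cons R n @^-1` A).
  exact: measurable_preimage (@measurable_rV_cons R n) mA.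
pose f1 := fun x : measurableTypeR R => (x + v ord0 ord0)%R : measurableTypeR R.
pose f2 := shift (\row_(j < n) v ord0 (lift ord0 j)).
have -> : @rV_cons R n @^-1` (shift v @^-1` A) =
    (fun x => (f1 x.1, f2 x.2)) @^-1` (@rV_cons R n @^-1` A).
  suff E x : shift v (rV_cons x) = rV_cons (f1 x.1, f2 x.2).
    by apply/seteqP; split => x /=; rewrite -E.
  apply/rowP => i; rewrite !mxE.
  by case: unliftP => [j ->|->] /=; rewrite ?mxE.
apply: product_measure1_invariant => //.
- by apply: measurable_funD => //; exact: measurable_cst.
- by move=> B; exact: lebesgue_measure_shift.
- by move=> B; exact: IHn.
Qed.

(** * Counting the points of a simple point measure *)

Section point_measure_count.
Context (R : realType) (d : nat) (p : point_measure R d).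
Implicit Types A C : set 'rV[R]_d.

Lemma bounded_setS A C : A `<=` C -> bounded_set C -> bounded_set A.
Proof.
move=> AC [M [Mr MC]]; exists M; split => // N MN x Ax.
exact: (MC N MN x (AC x Ax)).
Qed.

Lemma pm_fin_num A : measurable A -> bounded_set A -> p A \is a fin_num.
Proof. by move=> mA bA; have [k ->] := (pm_simple p).1 A mA bA. Qed.

Lemma pm_lt1_eq0 A : measurable A -> bounded_set A -> p A < 1 -> p A = 0.
Proof.
move=> mA bA; have [k ->] := (pm_simple p).1 A mA bA.
by rewrite lte_fin (ltr_nat R k 1) ltnS leqn0 => /eqP ->.
Qed.

(* [s] is the infimum of the [t] such that [p] charges [A] below level [t]. *)
Lemma pm_slice A (i : 'I_d) : measurable A -> bounded_set A -> 1 <= p A ->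
  exists s, 1 <= p (A `&` [set x | x ord0 i = s]).
Proof.
move=> mA bA pA; have [M [Mreal MA]] := bA.
pose H (Y : set (measurableTypeR R)) :=
  A `&` ((fun x : 'rV[R]_d => x ord0 i) @^-1` Y).
have mH Y : measurable Y -> measurable (H Y).
  by move=> mY; apply: measurableI => //; exact: measurable_preimage
    (measurable_coord i) mY.
have bH Y : bounded_set (H Y) by apply: bounded_setS bA => x [].
have HS Y Z : measurable Y -> measurable Z -> Y `<=` Z -> p (H Y) <= p (H Z).
  move=> mY mZ YZ; apply: le_measure; rewrite ?inE; [exact: mH|exact: mH|].
  by move=> x [Ax /YZ Zx]; split.
(* [bounded_set] bounds the norm by every number beyond [M], not by [M] itself, whence [M + 1]. *)
have coordM x : A x -> (`|x ord0 i| <= M + 1)%R.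
  move=> Ax; apply: le_trans (MA (M + 1)%R _ x Ax); last by rewrite ltrDl.
  rewrite -[leRHS]/(mx_norm x) mx_normrE.
  exact: (@le_bigmax _ _ _ 0%R (fun ij : 'I_1 * 'I_d => `|x ij.1 ij.2|%R) (ord0, i)).
pose S := [set t | 1 <= p (H `]-oo, t]%classic)].
have SM : S (M + 1)%R.
  rewrite /S /= (_ : H _ = A)//; apply/seteqP; split => [x []//|x Ax].
  by split => //=; rewrite in_itv /= (le_trans (ler_norm _))// coordM.
have S0 t : S t -> (- (M + 1) <= t)%R.
  move=> St; rewrite leNgt; apply/negP => tM.
  suff H0 : H `]-oo, t]%classic = set0.
    by move: St; rewrite /S /= H0 measure0 lee_fin ler10.
  rewrite -subset0 => x [Ax /=]; rewrite in_itv /= => xt.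
  have := le_trans (lerNnormlW (coordM x Ax)) xt.
  by rewrite leNgt tM.
have hS : has_inf S by split; [exists (M + 1)%R|exists (- (M + 1))%R].
pose s := inf S; exists s.
(* Continuity from above along the levels [s + 1/(n+1)]: each carries mass at least 1 because [S]
   has elements arbitrarily close to its infimum. *)
have ps : 1 <= p (H `]-oo, s]%classic).
  pose F n := H `]-oo, (s + n.+1%:R^-1)%R]%classic.
  have FE : \bigcap_n F n = H `]-oo, s]%classic.
    apply/seteqP; split => [x Fx|x [Ax /=]].
      have [Ax _] := Fx 0%N I; split => //=; rewrite in_itv /= leNgt.
      apply/negP => /ltr_add_invr[k sk]; have [_ /=] := Fx k I.
      by rewrite in_itv /= leNgt sk.
    rewrite in_itv /= => xs n _; split => //=; rewrite in_itv/=.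
    by rewrite (le_trans xs)// lerDl.
  have cF : p \o F @ \oo --> p (H `]-oo, s]%classic).
    rewrite -FE; apply: nonincreasing_cvg_mu.
    - by rewrite ltey_eq (pm_fin_num (mH _ _) (bH _)).
    - by move=> k; exact: mH.
    - by rewrite FE; exact: mH.
    - move=> m n mn; apply/subsetPset => x [Ax /=]; rewrite !in_itv/= => xs.
      split=> //=; rewrite in_itv /= (le_trans xs)// lerD2l.
      by rewrite lef_pV2 ?posrE// ler_nat.
  rewrite -(cvg_lim _ cF)//; apply: lime_ge; first by apply/cvg_ex; eexists; exact: cF.
  near=> n => /=.
  have [t St ts] := @inf_adherent _ S n.+1%:R^-1%R ltac:(by []) hS.
  by rewrite (le_trans St)// HS// => y /=; rewrite !in_itv /= => /le_trans -> //;
   exact: ltW.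
(* The levels [s - 1/(n+1)] lie outside [S], so their mass is below 1, hence 0 by integrality; a
   countable union keeps it 0. All the mass up to level [s] thus sits on the hyperplane. *)
have ps0 : p (H `]-oo, s[%classic) = 0.
  pose F n := H `]-oo, (s - n.+1%:R^-1)%R]%classic.
  have FE : H `]-oo, s[%classic = \bigcup_n F n.
    apply/seteqP; split => [x [Ax /=]|x [n _ [Ax /=]]].
      rewrite in_itv /= => /ltr_add_invr[k sk]; exists k => //; split => //=.
      by rewrite in_itv /= lerBrDr ltW.
    rewrite in_itv /= => xs; split => //=.
    by rewrite in_itv /= (le_lt_trans xs)// ltrBlDr ltrDl.
  apply/negligibleP; first exact: mH.
  rewrite FE; apply: negligible_bigcup => n; apply/negligibleP; first exact: mH.
  apply: pm_lt1_eq0; [exact: mH|exact: bH|].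
  rewrite ltNge; apply/negP => /(ge_inf hS.2); rewrite leNgt => /negP; apply.
  by rewrite ltrBlDr ltrDl.
have E : H `]-oo, s]%classic = H `]-oo, s[%classic `|`
   (A `&` [set x | x ord0 i = s]).
  rewrite /H -setIUr; congr (_ `&` _); apply/seteqP; split => x /=.
    rewrite !in_itv /= le_eqVlt => /predU1P[->|]; [by right|by left].
  by rewrite !in_itv /= => -[/ltW//|->].
move: ps; rewrite E measureU//.
- by move=> /=; rewrite [X in X + _]ps0 add0e.
- exact: mH.
- exact: mH [set s] _.
- rewrite -subset0 => x [[_ /=]]; rewrite in_itv/= => xs [_ /= xE].
  by rewrite xE ltxx in xs.
Unshelve. all: by end_near. Qed.

(** Slicing along each coordinate in turn keeps the mass at least 1 and leaves at most one point.
    Positive mass makes that set nonempty, and simplicity caps its mass at 1. *)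
Lemma pm_atom A : measurable A -> bounded_set A -> 1 <= p A ->
  exists2 z, A z & pm_support p z.
Proof.
move=> mA bA pA.
have [B [v [mB BA vB pB]]] : exists (B : set 'rV[R]_d) (v : 'I_d -> R),
    [/\ measurable B, B `<=` A, forall x (i : 'I_d), B x -> x ord0 i = v i &
        1 <= p B].
  suff H k : (k <= d)%N -> exists (B : set 'rV[R]_d) (v : 'I_d -> R),
      [/\ measurable B, B `<=` A,
        forall x (i : 'I_d), (i < k)%N -> B x -> x ord0 i = v i & 1 <= p B].
    have [B [v [mB BA vB pB]]] := H d (leqnn d).
    by exists B, v; split => // x i; exact: vB.
  elim: k => [_|k IH kd].
    by exists A, (fun=> 0%R); split.
  have [B [v [mB BA vB pB]]] := IH (ltnW kd).
  have [s ps] := pm_slice (Ordinal kd) mB (bounded_setS BA bA) pB.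
  exists (B `&` [set x | x ord0 (Ordinal kd) = s]),
    (fun j => if j == Ordinal kd then s else v j); split => //.
  - apply: measurableI => //.
    exact: measurable_preimage (measurable_coord (Ordinal kd))
      (measurable_set1 s).
  - by move=> x [/BA].
  - move=> x j; rewrite ltnS leq_eqVlt => jk [Bx xs].
    case: eqP => [-> //|/eqP jk']; apply: vB => //.
    by case/orP: jk => // /eqP jk; case/eqP: jk'; exact: val_inj.
have [z Bz] : B !=set0.
  apply/set0P/eqP => B0; move: pB; rewrite B0 measure0.
  by rewrite lee_fin ler10.
exists z; first exact: BA.
have {}vB : B `<=` [set z].
  by move=> x Bx; apply/rowP => i; rewrite (vB _ _ Bx) (vB _ _ Bz).
apply/eqP; rewrite eq_le (pm_simple p).2 /= (le_trans pB)//.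
by apply: le_measure; rewrite ?inE//; exact: measurable_rV_set1.
Qed.

Lemma measurable_finite_set C : finite_set C -> measurable C.
Proof.
move=> fC; rewrite (_ : C = \bigcup_(z in C) [set z]); last first.
  by apply/seteqP; split => [x Cx|x [y Cy ->//]]; exists x.
by apply: fin_bigcup_measurable => // z _; exact: measurable_rV_set1.
Qed.

Lemma pm_finite_set C : finite_set C -> C `<=` pm_support p ->
  p C = \sum_(xi \in C) (1 : \bar R).
Proof.
move=> fC Cp; rewrite {1}(_ : C = \bigcup_(z in C) [set z]); last first.
  by apply/seteqP; split => [x Cx|x [y Cy ->//]]; exists x.
rewrite measure_fin_bigcup//; last 2 first.
- by move=> x y Cx Cy [z [-> ->]].
- by move=> z _; exact: measurable_rV_set1.
by apply: eq_fsbigr => z; rewrite inE => /Cp.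
Qed.

(** If [C] has mass [k], then [k + 1] support points in it would already carry mass [k + 1]. *)
Lemma finite_pm_support C : measurable C -> bounded_set C ->
  finite_set (C `&` pm_support p).
Proof.
move=> mC bC; have [k pC] := (pm_simple p).1 C mC bC.
apply: contrapT => /(infinite_set_fset k.+1)[B BC].
apply/negP; rewrite -ltnNge ltnS -(ler_nat R) -lee_fin -pC.
have <- : p [set` B] = (#|` B|%:R)%:E.
  rewrite pm_finite_set//; last by move=> x /BC[].
  rewrite fsbig_finite// set_fsetK big_const_seq count_predT.
  by elim: (size _) => //= n ->; rewrite -EFinD nat1r.
apply: le_measure; rewrite ?inE//; first exact: measurable_finite_set.
by move=> x /BC[].
Qed.

(** Removing the support from [C] leaves no atom, so by [pm_atom] the remaining mass is below 1,
    hence 0. *)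
Lemma pm_count C : measurable C -> bounded_set C ->
  p C = \sum_(xi \in C `&` pm_support p) (1 : \bar R).
Proof.
move=> mC bC; have fC := finite_pm_support mC bC.
have mF := measurable_finite_set fC.
rewrite -(pm_finite_set fC); last by move=> x [].
have mD : measurable (C `\` (C `&` pm_support p)) by exact: measurableD.
have D0 : p (C `\` (C `&` pm_support p)) = 0.
  have bD : bounded_set (C `\` (C `&` pm_support p)).
    by apply: bounded_setS bC => x [].
  apply: pm_lt1_eq0 => //; rewrite ltNge; apply/negP => /(pm_atom mD bD).
  by move=> [z [Cz nz] pz]; apply: nz.
have FD : C `&` pm_support p `&` (C `\` (C `&` pm_support p)) = set0.
  by rewrite setDE setICA setICr setI0.
by rewrite -[RHS]adde0 -D0 -measureU// setDUK.
Qed.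

End point_measure_count.

(** * Territories *)

Lemma measurable_Center (R : realType) (d : nat) (C : set 'rV[R]_d) :
  measurable C -> measurable (@Center R d @` C).
Proof.
move=> mC; rewrite /measurable /= /alloc_value_measurable /=.
rewrite (_ : _ @^-1` _ = C)//; apply/seteqP; split => [x [y Cy [<-]//]|x Cx].
by exists x.
Qed.

Lemma measurable_Infty (R : realType) (d : nat) :
  measurable [set @Infty R d].
Proof.
rewrite /measurable /= /alloc_value_measurable /=.
by rewrite (_ : _ @^-1` _ = set0)//; apply/seteqP; split.
Qed.

Lemma measurable_Delta (R : realType) (d : nat) :
  measurable [set @Delta R d].
Proof.
rewrite /measurable /= /alloc_value_measurable /=.
by rewrite (_ : _ @^-1` _ = set0)//; apply/seteqP; split.
Qed.

Section territories.
Context (R : realType) (d : nat) (p : point_measure R d) (alpha : R).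
Variable psi : 'rV[R]_d -> alloc_value R d.
Hypothesis psi_alloc : allocation (pm_support p) alpha psi.
Local Notation L := (lebesgue_rV R d).

Let mpsi : measurable_fun setT psi. Proof. by case: psi_alloc. Qed.

Lemma measurable_territory xi : measurable (territory psi xi).
Proof.
rewrite /territory -image_set1.
exact: measurable_preimage mpsi (measurable_Center (measurable_rV_set1 xi)).
Qed.

(** Boundedness of [C] leaves finitely many centers, so the disjoint territories form a finite
    union. *)
Lemma lebesgue_territories (C : set 'rV[R]_d) :
  measurable C -> bounded_set C ->
  L (psi @^-1` (@Center R d @` C)) =
  \sum_(xi \in C `&` pm_support p) L (territory psi xi).
Proof.
move=> mC bC; case: psi_alloc => _ psiX _ _.
rewrite [X in L X](_ : _ =
    \bigcup_(xi in C `&` pm_support p) territory psi xi); last first.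
  apply/seteqP; split => [x [y Cy /esym yx]|x [y [Cy _] yx]].
    by exists y => //; split => //; exact: psiX yx.
  by exists y.
apply: measure_fin_bigcup; first exact: finite_pm_support.
- by move=> x y _ _ [z []]; rewrite /territory /= => -> [].
- by move=> xi _; exact: measurable_territory.
Qed.

Lemma lebesgue_territories_le (C : set 'rV[R]_d) : (0 <= alpha)%R ->
  measurable C -> bounded_set C ->
  L (psi @^-1` (@Center R d @` C)) <= alpha%:E * p C.
Proof.
move=> a0 mC bC; rewrite lebesgue_territories// pm_count// ge0_mule_fsumr//.
apply: lee_fsum; first exact: finite_pm_support.
by move=> xi [_ pxi]; rewrite mule1; case: psi_alloc => _ _ _; exact.
Qed.

Lemma lebesgue_territories_sated (C : set 'rV[R]_d) :
  measurable C -> bounded_set C ->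
  (forall xi, C xi -> pm_support p xi -> sated alpha psi xi) ->
  L (psi @^-1` (@Center R d @` C)) = alpha%:E * p C.
Proof.
move=> mC bC sat; rewrite lebesgue_territories// pm_count// ge0_mule_fsumr//.
apply: eq_fsbigr => xi; rewrite inE => -[Cxi pxi].
by rewrite mule1; exact: sat.
Qed.

(** Equality case of [lebesgue_territories_le]: a deficit at the single center [xi] cannot be made
    up by the other centers of [C]. *)
Lemma sated_territories (C : set 'rV[R]_d) (xi : 'rV[R]_d) : (0 <= alpha)%R ->
  measurable C -> bounded_set C ->
  L (psi @^-1` (@Center R d @` C)) = alpha%:E * p C ->
  C xi -> pm_support p xi -> sated alpha psi xi.
Proof.
move=> a0 mC bC LC Cxi pxi.
have mx := measurable_rV_set1 xi.
have mC' : measurable (C `\ xi) by exact: measurableD.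
have bC' : bounded_set (C `\ xi) by apply: bounded_setS bC => x [].
have xiC : [set xi] `<=` C by move=> _ ->.
have CE : C = [set xi] `|` (C `\ xi) by rewrite setDUK.
have I0 : [set xi] `&` (C `\ xi) = set0 by rewrite setDIK.
have LT : L (territory psi xi) <= alpha%:E.
  by case: psi_alloc => _ _ _; exact.
apply/eqP; rewrite eq_le LT /=.
have pC : p C = 1 + p (C `\ xi) by rewrite -[X in X + _]pxi {1}CE measureU//.
have LU : L (psi @^-1` (@Center R d @` C)) =
    L (territory psi xi) + L (psi @^-1` (@Center R d @` (C `\ xi))).
  rewrite {1}CE image_setU preimage_setU image_set1 measureU//.
  - exact: measurable_territory.
  - exact: measurable_preimage mpsi (measurable_Center mC').
  - by rewrite -subset0 => x [/= ->] [y [_ yxi] [/yxi]].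
have pF : p (C `\ xi) \is a fin_num by exact: pm_fin_num.
rewrite leNgt; apply/negP => lt1; move: LC.
rewrite LU pC ge0_muleDr// mule1.
(* This also bounds the volume of the other territories by a finite number, so the strict inequality
   at [xi] survives the addition. *)
have le' := lebesgue_territories_le a0 mC' bC'.
apply/eqP; rewrite lt_eqF//; apply: lte_leD => //.
by rewrite ge0_fin_numE// (le_lt_trans le')// ltey_eq fin_numM.
Qed.

End territories.

(** * The unit cube and its integer translates *)

Section unit_cube.
Context (R : realType) (d : nat).
Local Notation Q := (@box R d (fun=> 0%R) (fun=> 1%R)).

Lemma measurable_unit_box : measurable Q.
Proof.
rewrite (_ : Q = \bigcap_(i in [set: 'I_d])
   ((fun x : 'rV[R]_d => x ord0 i) @^-1` `[0%R, 1%R[%classic)).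
  apply: fin_bigcap_measurable => // i _.
  by apply: measurable_preimage; [exact: measurable_coord|exact: measurable_itv].
by apply/seteqP; split => x /= h i; [move=> _; exact: h|exact: h].
Qed.

Lemma bounded_unit_box : bounded_set Q.
Proof.
exists 1%R; split => // M M1 x Qx /=; rewrite -[leLHS]/(mx_norm x) mx_normrE.
apply/bigmax_leP; split => [|[i j] _ /=]; first by rewrite (le_trans _ (ltW M1)).
rewrite (ord1 i); have := Qx j; rewrite in_itv /= => /andP[x0 x1].
by rewrite ger0_norm// (le_trans (ltW x1) (ltW M1)).
Qed.

Lemma lebesgue_unit_box : lebesgue_rV R d Q = 1.
Proof.
by rewrite lebesgue_rV_box// big1 // => i _; rewrite subr0.
Qed.

(** For either sign the floor of [a] forces the integer; applied to each coordinate, this identifies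
    the tile containing a given point. *)
Lemma signed_shift_unit_itv (s : bool) (a : R) (m : int) :
  ((0 <= a + (-1) ^+ s * m%:~R < 1) = (m == (-1) ^+ (~~ s) * Num.floor a))%R.
Proof.
rewrite -[RHS](can_eq (signrMK (~~ s))) signrMK [RHS]eq_sym floor_eq.
case: s => /=; rewrite !(expr0, expr1, mul1r, mulN1r) intrD ?intrN.
  by rewrite subr_ge0 ltrBlDr addrC.
by rewrite -lerBlDr sub0r -ltrBrDr [(1 - _)%R]addrC.
Qed.

(* The same [z], an enumeration of Z^d, tiles space both by its translates and
   by those of its opposite, which is what a mass transport needs. *)
Lemma unit_box_lattice : (0 < d)%N -> exists z : nat -> 'rV[R]_d,
  forall s : bool, let F k := shift ((-1) ^+ s *: z k)%R @^-1` Q in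
    trivIset setT F /\ \bigcup_k F k = setT.
Proof.
move=> d0.
(* An enumeration by all of [nat] requires Z^d to be infinite; constant vectors show it, told apart
   by a coordinate that exists since [d > 0]. *)
have inf : infinite_set [set: 'rV[int]_d].
  pose h (n : nat) : 'rV[int]_d := const_mx n%:Z.
  have hinj : injective h.
    by move=> m n /rowP/(_ (Ordinal d0)); rewrite !mxE => -[].
  have hN := @inj_card_eq _ _ [set: nat] h (in2W hinj).
  have hT : [set h n | n in [set: nat]] `<=` [set: 'rV[int]_d] by [].
  apply: sub_infinite_set hT _.
  by rewrite (eq_finite_set hN); exact: infinite_nat.
have [g [_ ginj gsurj]] :=
  elimT card_set_bijP (eq_card_nat (@countableP _ [set: 'rV[int]_d]) inf).
have [f fK] : {f & forall k, g (f k) = k}.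
  apply: (@boolp.choice _ _ (fun k v => g v = k)) => k.
  by have [v _ <-] := gsurj k I; exists v.
have gK v : f (g v) = v by apply: ginj; rewrite ?inE.
exists (fun k => map_mx (fun m : int => m%:~R : R) (f k)) => s F.
(* The signed floors of [x] determine its tile: their uniqueness gives disjointness, their existence
   gives covering. *)
have FP k x : F k x <-> f k = (\row_i ((-1) ^+ (~~ s) * Num.floor (x ord0 i)))%R.
  rewrite /F /box /=; split => [h|fk i].
    by apply/rowP => i; rewrite mxE; apply/eqP; rewrite -signed_shift_unit_itv; have := h i; rewrite !mxE.
  by rewrite !mxE in_itv/= signed_shift_unit_itv fk mxE.
split.
- apply/trivIsetP => i j _ _; apply: contraNeq => /set0P[x []].
  by rewrite !FP => fi fj; apply/eqP/(can_inj fK); rewrite fi fj.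
- rewrite -subTset => x _.
  exists (g (\row_i ((-1) ^+ (~~ s) * Num.floor (x ord0 i)))%R) => //.
  by apply/FP; rewrite gK.
Qed.

End unit_cube.

(** * Translates of point measures, and auxiliary facts *)

Section translate.
Context (R : realType) (d : nat).

Lemma measurable_translate (v : 'rV[R]_d) : measurable_fun setT (translate v).
Proof.
apply: (@measurability _ _ _ _ setT (translate v)
  (\bigcup_(A in measurable)
    preimage_set_system [set: point_measure R d] (pm_ev A) measurable)) => //.
move=> _ [_ [A mA [B mB <-]] <-]; rewrite !setTI; apply: sub_sigma_algebra.
have mA' := measurable_preimage (@measurable_shift R d v) mA.
by exists (shift v @^-1` A) => //; exists B => //; rewrite setTI.
Qed.

Lemma measurable_pm_ev (A : set 'rV[R]_d) : measurable A ->
  measurable_fun setT (@pm_ev R d A).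
Proof.
move=> mA _ Y mY; apply: sub_sigma_algebra.
by exists A => //; exists Y.
Qed.

Lemma pm_support_translate (v : 'rV[R]_d) (p : point_measure R d) xi :
  pm_support (translate v p) (shift v xi) = pm_support p xi.
Proof.
rewrite /pm_support /= /pm_pushforward /pushforward.
by rewrite (_ : _ @^-1` _ = [set xi])//; apply/seteqP; split=> x /= => [/addIr|->].
Qed.

End translate.

(** An unclaimed site desires every center and an unsated center covets every site not its own, so
    together they would form an unstable pair. *)
Lemma stable_unclaimed_sated (R : realType) (d : nat) (Xi : set 'rV[R]_d)
    (alpha : R) (psi : 'rV[R]_d -> alloc_value R d) (x xi : 'rV[R]_d) :
  stable Xi alpha psi -> psi x = Infty -> Xi xi -> sated alpha psi xi.
Proof.
move=> st px Xxi; apply: contrapT => nsat; apply: (st x xi); split => //.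
- by rewrite px.
- by rewrite px.
- by right.
- by right.
Qed.

Lemma probability_eq1P d (T : measurableType d) (R : realType)
    (P : probability T R) (A : set T) : measurable A ->
  P A = 1 <-> P (~` A) = 0.
Proof.
move=> mA; rewrite probability_setC//; split => [->|]; first by rewrite subee.
by move/eqP; rewrite sube_eq ?fin_num_measure// add0e => /eqP.
Qed.

(** The finite integral of [g] permits subtraction: [g - f] is nonnegative with integral 0. This
    later turns an equality of means into almost sure satedness. *)
Lemma ge0_le_integral_eq_ae d (T : measurableType d) (R : realType)
    (mu : {measure set T -> \bar R}) (f g : T -> \bar R) :
  measurable_fun setT f -> measurable_fun setT g ->
  (forall x, 0 <= f x <= g x) -> (forall x, g x < +oo) ->
  \int[mu]_x g x < +oo -> \int[mu]_x f x = \int[mu]_x g x ->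
  ae_eq mu setT f g.
Proof.
move=> mf mg fg goo ig fgE.
have f0 x : 0 <= f x by have /andP[] := fg x.
have fg' x : f x <= g x by have /andP[] := fg x.
have g0 x : 0 <= g x by exact: le_trans (fg' x).
have ffin x : f x \is a fin_num by rewrite ge0_fin_numE// (le_lt_trans (fg' x)).
have Ig : mu.-integrable setT g.
  by apply/integrableP; split => //; under eq_integral do rewrite gee0_abs//.
have If : mu.-integrable setT f.
  apply: (le_integrable _ mf _ Ig) => // x _.
  by rewrite !gee0_abs// fg'.
have : \int[mu]_x `|g x - f x| = 0.
  transitivity (\int[mu]_x (g x - f x)).
    by apply: eq_integral => x _; rewrite gee0_abs// suber_ge0.
  rewrite integralB// fgE subee// ge0_fin_numE//; exact: integral_ge0.
move/ae_eq_integral_abs => /(_ measurableT).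
have mgf : measurable_fun setT (fun x => g x - f x) by exact: emeasurable_funB.
move=> /(_ mgf); apply: filterS => x /= /(_ I) gf _.
by rewrite -[RHS](subeK _ (ffin x)) gf add0e.
Qed.

(** * Mass transport *)

Section mass_transport.
Context (R : realType) (d : nat) (P : probability (point_measure R d) R).
Variables (alpha lambda : R) (D : set (point_measure R d)).
Variable Psi : point_measure R d -> 'rV[R]_d -> alloc_value R d.
Hypothesis (d_gt0 : (0 < d)%N) (alpha_gt0 : (0 < alpha)%R).
Hypothesis P_inv : translation_invariant P.
Hypothesis P_int : intensity P = lambda%:E.
Hypothesis fa : factor_allocation P alpha D Psi.

Local Notation L := (lebesgue_rV R d).
Local Notation M := (P \x L).
Local Notation Q := (@box R d (fun=> 0%R) (fun=> 1%R)).
Local Notation centers C := (@Center R d @` C).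

(** Its [M]-measure is the mean volume of the sites of [B] whose value lies in [Y]; the condition
    [D] discards the irrelevant values of [Psi]. *)
Definition alloc_graph (B : set 'rV[R]_d) (Y : set (alloc_value R d)) :
    set (point_measure R d * 'rV[R]_d) :=
  [set px | [/\ D px.1, B px.2 & Y (Psi px.1 px.2)]].

Let mD : measurable D. Proof. exact: fa_measurable_dom fa. Qed.

Let mQ : measurable Q. Proof. exact: measurable_unit_box. Qed.

Let bQ : bounded_set Q. Proof. exact: bounded_unit_box. Qed.

Lemma measurable_alloc_graph B Y :
  measurable B -> measurable Y -> measurable (alloc_graph B Y).
Proof.
move=> mB mY.
rewrite (_ : alloc_graph B Y = (D `*` [set: 'rV[R]_d]) `&`
    (fun px => Psi px.1 px.2) @^-1` Y `&` (setT `*` B)); last first.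
  by apply/seteqP; split => -[p x] /=; [move=> [? ? ?]|move=> [[[? ?] ?] [? ?]]].
apply: measurableI; last exact: measurableX.
by apply: (fa_measurable fa) => //; exact: measurableX.
Qed.

Lemma xsection_alloc_graph B Y p : D p ->
  xsection (alloc_graph B Y) p = B `&` Psi p @^-1` Y.
Proof.
move=> Dp; apply/seteqP; split => x; rewrite /xsection /= inE /=.
  by move=> -[].
by move=> -[].
Qed.

Lemma xsection_alloc_graph0 B Y p : ~ D p ->
  xsection (alloc_graph B Y) p = set0.
Proof.
by move=> Dp; rewrite -subset0 => x; rewrite /xsection /= inE /= => -[].
Qed.

(** By equivariance, the preimage of a graph under the diagonal translation is again a graph, and
    [M] is invariant under that translation. *)
Lemma alloc_graph_shift (v : 'rV[R]_d) B Y : measurable B -> measurable Y ->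
  M (alloc_graph (shift v @^-1` B) (shift_value v @^-1` Y)) =
  M (alloc_graph B Y).
Proof.
move=> mB mY.
rewrite -(@product_measure1_invariant _ _ _ _ R P L (translate v) (shift v)
  (alloc_graph B Y)).
- congr (M _); apply/seteqP; split => -[p x] /= [Dp Bx Yx]; split => //=.
  + exact/(fa_translate_dom fa).
  + by rewrite (fa_equivariant fa).
  + exact/(fa_translate_dom fa v).
  + by rewrite -(fa_equivariant fa)//; exact/(fa_translate_dom fa v).
- exact: measurable_translate.
- exact: P_inv.
- exact: lebesgue_rV_shift.
- exact: measurable_alloc_graph.
Qed.

(** The left side is cut according to the tile of the center, the right side according to the tile
    of the site. Opposite signs in the two tilings make the pieces of equal index translates of each
    other. *)
Lemma mass_transport :
  M (alloc_graph Q (centers setT)) = M (alloc_graph setT (centers Q)).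
Proof.
have [z zP] := unit_box_lattice R d_gt0.
have [/trivIsetP t0 c0] := zP false; have [/trivIsetP t1 c1] := zP true.
pose F (s : bool) k := shift ((-1) ^+ s *: z k)%R @^-1` Q.
have mF s k : measurable (F s k).
  exact: measurable_preimage (@measurable_shift _ _ _) mQ.
have -> : alloc_graph Q (centers setT) =
    \bigcup_k alloc_graph Q (centers (F false k)).
  apply/seteqP; split => -[p x] /=.
    move=> [Dp Qx [xi _ pxi]]; have [k _ Fk] : (\bigcup_k F false k) xi.
      by rewrite c0.
    by exists k => //; split => //=; exists xi.
  by move=> [k _ [Dp Qx [xi _ pxi]]]; split => //=; exists xi.
have -> : alloc_graph setT (centers Q) =
    \bigcup_k alloc_graph (F true k) (centers Q).
  apply/seteqP; split => -[p x] /=.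
    move=> [Dp _ Yx]; have [k _ Fk] : (\bigcup_k F true k) x by rewrite c1.
    by exists k.
  by move=> [k _ [Dp _ Yx]]; split.
rewrite !measure_semi_bigcup.
- apply: eq_eseriesr => k _.
  have mFk := measurable_Center (mF false k).
  (* Translation by [z k] carries [Q] to [F true k] and [F false k] to [Q]. *)
  rewrite -[LHS](alloc_graph_shift ((-1) ^+ true *: z k)%R mQ mFk).
  congr (M (alloc_graph _ _)); apply/seteqP; split => -[xi| |] /=; try by case.
  + move=> [c + [cE]]; rewrite {}cE /F /= expr0 scale1r expr1 scaleN1r subrK.
    by exists xi.
  + move=> [c Qc [<-]]; exists (shift ((-1) ^+ true *: z k)%R c) => //.
    by rewrite /F /= expr0 scale1r expr1 scaleN1r subrK.
- move=> k; apply: measurable_alloc_graph => //; exact: measurable_Center.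
- apply/trivIsetP => i j _ _ ij; have := t1 i j I I ij.
  rewrite -!subset0 => t1ij [p x] [[_ Fi _] [_ Fj _]]; exact: (t1ij x).
- apply: bigcupT_measurable => k.
  by apply: measurable_alloc_graph => //; exact: measurable_Center.
- by move=> k; apply: measurable_alloc_graph => //; exact: measurable_Center.
- apply/trivIsetP => i j _ _ ij; have := t0 i j I I ij.
  rewrite -!subset0 => t0ij [p x] /= [[_ _ [c Fi cx]] [_ _ [c' Fj]]].
  by rewrite -cx => -[cc]; apply: (t0ij c); split => //; rewrite -cc.
- apply: bigcupT_measurable => k.
  by apply: measurable_alloc_graph => //; exact: measurable_Center.
Qed.

Lemma P_dom : P D = 1.
Proof.
apply/probability_eq1P => //; apply/negligibleP; first exact: measurableC.
exact: fa_ae_dom fa.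
Qed.

(** The value at a site is a center, [Infty] or [Delta]; the last has volume 0 for every [p] in [D],
    and [D] times the cube has mass 1. *)
Lemma unit_volume_split :
  M (alloc_graph Q (centers setT)) + M (alloc_graph Q [set Infty]) = 1.
Proof.
have mC := measurable_alloc_graph mQ (measurable_Center (@measurableT _ 'rV[R]_d)).
have mI := measurable_alloc_graph mQ (@measurable_Infty R d).
have mDe := measurable_alloc_graph mQ (@measurable_Delta R d).
have De0 : M (alloc_graph Q [set Delta]) = 0.
  rewrite /product_measure1; apply: integral0_eq => p _ /=.
  have [Dp|Dp] := pselect (D p); last by rewrite xsection_alloc_graph0.
  rewrite xsection_alloc_graph//.
  have [mpsi _ De _] := fa_allocation fa Dp.
  have mp : measurable (Psi p @^-1` [set Delta]).
    exact: measurable_preimage mpsi (@measurable_Delta R d).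
  by apply: subset_measure0 De => //; exact: measurableI.
have MDQ : M (D `*` Q) = 1.
  rewrite product_measure1E// -[RHS]mule1.
  by congr (_ * _); [exact: P_dom|exact: lebesgue_unit_box].
have DQ : D `*` Q = alloc_graph Q (centers setT) `|` alloc_graph Q [set Infty]
    `|` alloc_graph Q [set Delta].
  apply/seteqP; split => -[p x] /=.
    move=> [Dp Qx]; rewrite /alloc_graph /=; case E : (Psi p x) => [c| |].
    - by left; left; split => //; exists c.
    - by left; right.
    - by right.
  by move=> [[[]|[]]|[]].
have CI0 : alloc_graph Q (centers setT) `&` alloc_graph Q [set Infty] = set0.
  by rewrite -subset0 => -[p x] [[_ _ [c _ /= cE]] [_ _ /=]]; rewrite -cE.
have CID0 : (alloc_graph Q (centers setT) `|` alloc_graph Q [set Infty])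
    `&` alloc_graph Q [set Delta] = set0.
  rewrite -subset0 => -[p x] [[[_ _ [c _ /= cE]]|[_ _ /= cE]] [_ _ /=]].
    by rewrite -cE.
  by rewrite cE.
rewrite -[RHS]MDQ DQ measureU//; last exact: measurableU.
by rewrite measureU// -[LHS]adde0 -De0.
Qed.

(** * The unclaimed volume and its mean *)

Definition unclaimed_volume p := L (unclaimed_sites (Psi p)).

Lemma measurable_unclaimed_sites p : D p -> measurable (unclaimed_sites (Psi p)).
Proof.
move=> Dp; have [mpsi _ _ _] := fa_allocation fa Dp.
exact: measurable_preimage mpsi (@measurable_Infty R d).
Qed.

Lemma measurable_fun_unclaimed_volume : measurable_fun D unclaimed_volume.
Proof.
apply: (@eq_measurable_fun _ _ _ _ D
    (L \o xsection (alloc_graph setT [set Infty]))).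
  by move=> p; rewrite inE => Dp /=; rewrite xsection_alloc_graph// setTI.
apply/measurable_funTS/measurable_fun_xsection.
by apply: measurable_alloc_graph => //; exact: measurable_Infty.
Qed.

Lemma unclaimed_volume_translate v p : D p ->
  unclaimed_volume (translate v p) = unclaimed_volume p.
Proof.
move=> Dp; have Dvp : D (translate v p) by exact/(fa_translate_dom fa).
rewrite /unclaimed_volume -(@lebesgue_rV_shift _ _ v (unclaimed_sites (Psi (translate v p)))).
  congr (L _); apply/seteqP; split => x; rewrite /unclaimed_sites /=;
    rewrite -[(x + v)%R]/(shift v x) (fa_equivariant fa)//.
    by case: (Psi p x).
  by move=> ->.
exact: measurable_unclaimed_sites.
Qed.

Lemma mean_unclaimed_volume :
  M (alloc_graph setT [set Infty]) = \int[P]_(p in D) unclaimed_volume p.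
Proof.
rewrite /product_measure1 [RHS]integral_mkcond; apply: eq_integral => p _ /=.
rewrite patchE; case: ifPn; rewrite ?inE ?notin_setE => Dp.
  by rewrite xsection_alloc_graph// setTI.
by rewrite xsection_alloc_graph0// measure0.
Qed.

(** All tiles contribute equally, since [shift_value] fixes [Infty]. *)
Lemma mean_unclaimed_volume_series :
  M (alloc_graph setT [set Infty]) =
  \sum_(0 <= k <oo) M (alloc_graph Q [set Infty]).
Proof.
have mI := @measurable_Infty R d.
have [z zP] := unit_box_lattice R d_gt0.
have [/trivIsetP t0 c0] := zP false.
pose F k := shift ((-1) ^+ false *: z k)%R @^-1` Q.
have mF k : measurable (F k).
  exact: measurable_preimage (@measurable_shift _ _ _) mQ.
have -> : alloc_graph setT [set Infty] =
    \bigcup_k alloc_graph (F k) [set Infty].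
  apply/seteqP; split => -[p x] /=.
    move=> [Dp _ Yx]; have [k _ Fk] : (\bigcup_k F k) x by rewrite c0.
    by exists k.
  by move=> [k _ [Dp _ Yx]]; split.
rewrite measure_semi_bigcup.
- apply: eq_eseriesr => k _.
  rewrite -[RHS](alloc_graph_shift ((-1) ^+ false *: z k)%R mQ mI).
  by congr (M (alloc_graph _ _)); apply/seteqP; split => -[].
- by move=> k; apply: measurable_alloc_graph.
- apply/trivIsetP => i j _ _ ij; have := t0 i j I I ij.
  rewrite -!subset0 => t0ij [p x] [[_ Fi _] [_ Fj _]]; exact: (t0ij x).
- by apply: bigcupT_measurable => k; apply: measurable_alloc_graph.
Qed.

Lemma mean_unclaimed_volume_eq0 : M (alloc_graph Q [set Infty]) = 0 ->
  \int[P]_(p in D) unclaimed_volume p = 0.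
Proof.
by rewrite -mean_unclaimed_volume mean_unclaimed_volume_series => ->;
  rewrite eseries0.
Qed.

Lemma mean_unclaimed_volume_pinfty : 0 < M (alloc_graph Q [set Infty]) ->
  \int[P]_(p in D) unclaimed_volume p = +oo.
Proof.
rewrite -mean_unclaimed_volume mean_unclaimed_volume_series.
set u := M _ => u0; apply/eqyP => A A0.
(* The infinite case is separated because [fine] would send it to 0. *)
have [->|ufin] := eqVneq u +oo.
  rewrite (@nneseries_recl _ xpredT)//.
  by rewrite addye ?leey// gt_eqF// (lt_le_trans (ltNyr 0%R)) ?nneseries_ge0.
have {}ufin : u \is a fin_num by rewrite ge0_fin_numE ?ltey// ltW.
have u0' : (0 < fine u)%R by rewrite fine_gt0// u0 ltey_eq ufin.
(* Archimedes: the first [n] copies of [u] already exceed [A]. *)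
pose n := Num.bound (A / fine u).
rewrite (@nneseries_split _ _ 0 n); last by move=> k _; exact: ltW.
rewrite -[leLHS]adde0 leeD//; last first.
  by apply: nneseries_ge0 => k _ _; exact: ltW.
rewrite -(fineK ufin) sumEFin sumr_const_nat lee_fin add0n subn0.
by rewrite -mulr_natl -ler_pdivrMr// ltW// archi_boundP// divr_ge0// ?ltW//.
Qed.


(** * Satedness and the mean claimed volume *)

Definition sated_in (C : set 'rV[R]_d) : set (point_measure R d) :=
  [set p | D p /\
    forall xi, C xi -> pm_support p xi -> sated alpha (Psi p) xi].

Lemma sated_in_translate v C p :
  sated_in C (translate v p) <-> sated_in (shift v @^-1` C) p.
Proof.
have terrE xi : D p ->
    L (territory (Psi (translate v p)) (shift v xi)) = L (territory (Psi p) xi).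
  move=> Dp; have Dvp : D (translate v p) by exact/(fa_translate_dom fa).
  have mT := measurable_territory (fa_allocation fa Dvp) (shift v xi).
  rewrite -(lebesgue_rV_shift v mT); congr (L _).
  apply/seteqP; split => x; rewrite /territory /=;
    rewrite -[(x + v)%R]/(shift v x) (fa_equivariant fa)//.
    by case: (Psi p x) => //= c [/addIr ->].
  by move=> ->.
split=> -[Dp sat].
  have {}Dp : D p by exact/(fa_translate_dom fa v).
  split => // xi Cxi pxi; rewrite /sated -terrE//; apply: sat => //.
  by rewrite pm_support_translate.
split; first exact/(fa_translate_dom fa v).
move=> xi Cxi; rewrite -[xi](subrK v) -[(_ + v)%R]/(shift v _).
rewrite pm_support_translate /sated terrE// => pxi; apply: sat => //=.
by rewrite subrK.
Qed.

(** The total volume of the territories of the centers in the cube; written as a section, it is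
    measurable everywhere and vanishes outside [D]. *)
Let claims p := L (xsection (alloc_graph setT (centers Q)) p).

Let mclaims : measurable_fun setT claims.
Proof.
apply: (measurable_fun_xsection L).
by apply: measurable_alloc_graph => //; exact: measurable_Center.
Qed.

Let claimsE p : D p -> claims p = L (Psi p @^-1` (centers Q)).
Proof. by move=> Dp; rewrite /claims xsection_alloc_graph// setTI. Qed.

Let mcount : measurable_fun setT (fun p => alpha%:E * pm_ev Q p).
Proof. by apply: measurable_funeM; exact: measurable_pm_ev. Qed.

Let claims_le p : claims p <= alpha%:E * pm_ev Q p.
Proof.
have [Dp|Dp] := pselect (D p).
  rewrite claimsE//; apply: (lebesgue_territories_le (fa_allocation fa Dp)) => //.
  exact: ltW.
by rewrite /claims xsection_alloc_graph0// measure0 mule_ge0// lee_fin ltW.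
Qed.

Let mean_count : \int[P]_p (alpha%:E * pm_ev Q p) = (lambda * alpha)%:E.
Proof.
rewrite ge0_integralZl//.
- by rewrite [X in _ * X]P_int -EFinM mulrC.
- exact: measurable_pm_ev.
- by rewrite lee_fin ltW.
Qed.

Lemma sated_in_unit_box p : sated_in Q p <->
  D p /\ claims p = alpha%:E * pm_ev Q p.
Proof.
split=> -[Dp H]; split => //.
  by rewrite claimsE//; exact: (lebesgue_territories_sated (fa_allocation fa Dp)).
move=> xi; apply: (sated_territories (fa_allocation fa Dp)) => //.
  exact: ltW.
by rewrite -claimsE.
Qed.

Lemma measurable_sated_in_unit_box : measurable (sated_in Q).
Proof.
rewrite (_ : sated_in Q = D `&` [set p | claims p = alpha%:E * pm_ev Q p]).
  by apply: measurable_eqe => //; exact: measurable_funTS.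
by apply/seteqP; split => p /sated_in_unit_box.
Qed.

(* Reduces the measurability of "all centers are sated" to the cube, where it is
   an equality of two measurable functions. *)
Lemma sated_in_bigcap : exists z : nat -> 'rV[R]_d,
  sated_in setT = \bigcap_k (translate (z k) @^-1` sated_in Q).
Proof.
have [z zP] := unit_box_lattice R d_gt0; have [_ c0] := zP false.
exists (fun k => (-1) ^+ false *: z k)%R.
apply/seteqP; split => [p [Dp sat] k _|p sat] /=.
  by apply/sated_in_translate; split => // xi _; exact: sat.
have {}sat k : sated_in (shift ((-1) ^+ false *: z k)%R @^-1` Q) p.
  by apply/sated_in_translate; exact: sat.
split=> [|xi _ pxi]; first by case: (sat 0%N).
have [k _ Fk] : (\bigcup_k shift ((-1) ^+ false *: z k)%R @^-1` Q) xi.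
  by rewrite c0.
by have [_] := sat k; exact.
Qed.

Lemma measurable_sated_in : measurable (sated_in setT).
Proof.
have [z ->] := sated_in_bigcap; apply: bigcapT_measurable => k.
exact: measurable_preimage (@measurable_translate _ _ _)
  measurable_sated_in_unit_box.
Qed.

Lemma mean_claimed_le : M (alloc_graph Q (centers setT)) <= (lambda * alpha)%:E.
Proof.
rewrite mass_transport -mean_count.
by apply: ge0_le_integral => // p _; rewrite mule_ge0// ?lee_fin ?ltW// measure_ge0.
Qed.

Lemma mean_claimed_sated : P (sated_in setT) = 1 ->
  M (alloc_graph Q (centers setT)) = (lambda * alpha)%:E.
Proof.
move=> /(probability_eq1P _ measurable_sated_in) S0.
rewrite mass_transport -mean_count.
apply: ge0_ae_eq_integral => //.
  by move=> p _; rewrite mule_ge0// ?lee_fin ?ltW// measure_ge0.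
exists (~` sated_in setT); split => //.
  by apply: measurableC; exact: measurable_sated_in.
move=> p /= H [Dp sat]; apply: H => _.
by have /sated_in_unit_box[_] : sated_in Q p by split => // xi _; exact: sat.
Qed.

(** Equal means force equality in [claims_le] almost surely, so the centers in the cube are sated;
    stationarity extends this to each of the countably many tiles. *)
Lemma sated_mean_claimed :
  M (alloc_graph Q (centers setT)) = (lambda * alpha)%:E ->
  P (sated_in setT) = 1.
Proof.
rewrite mass_transport -mean_count => meanE.
have ae : ae_eq P setT claims (fun p => alpha%:E * pm_ev Q p).
  apply: ge0_le_integral_eq_ae => //.
  - by move=> p; rewrite claims_le measure_ge0.
  - by move=> p; rewrite ltey_eq fin_numM// pm_fin_num.
  - by rewrite mean_count ltry.
have SQ0 : P (~` sated_in Q) = 0.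
  apply/negligibleP; first by apply: measurableC; exact: measurable_sated_in_unit_box.
  apply: negligibleS (negligibleU (fa_ae_dom fa) ae) => p /= nsat.
  apply: contrapT => /not_orP[/contrapT Dp /contrapT/(_ I) cE]; apply: nsat.
  exact/sated_in_unit_box.
apply/probability_eq1P; first exact: measurable_sated_in.
apply/negligibleP; first by apply: measurableC; exact: measurable_sated_in.
have [z ->] := sated_in_bigcap; rewrite setC_bigcap.
apply: negligible_bigcup => k.
have mS := measurable_sated_in_unit_box.
apply/negligibleP.
  by apply: measurableC; exact: measurable_preimage (@measurable_translate _ _ _) mS.
by rewrite -SQ0 -[RHS](P_inv (z k))//; exact: measurableC.
Qed.

End mass_transport.

(** * The three regimes *)

Section ergodicity.
Context (R : realType) (d : nat) (P : probability (point_measure R d) R).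
Variables (alpha lambda : R) (D : set (point_measure R d)).
Variable Psi : point_measure R d -> 'rV[R]_d -> alloc_value R d.
Hypothesis (d_gt0 : (0 < d)%N) (alpha_gt0 : (0 < alpha)%R).
Hypothesis P_inv : translation_invariant P.
Hypothesis P_int : intensity P = lambda%:E.
Hypothesis fa : factor_allocation P alpha D Psi.

Local Notation L := (lebesgue_rV R d).
Local Notation M := (P \x L).
Local Notation Q := (@box R d (fun=> 0%R) (fun=> 1%R)).
Local Notation centers C := (@Center R d @` C).


Hypothesis P_erg : ergodic P.

Local Notation alloc_graph := (alloc_graph D Psi).
Local Notation unclaimed_volume := (unclaimed_volume Psi).
Local Notation sated_in := (sated_in alpha D Psi).

(** Membership in [D] is part of the event so that it is measurable and exactly translation
    invariant, as [ergodic] demands. *)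
Definition volume_in (A : set (\bar R)) : set (point_measure R d) :=
  [set p | D p /\ A (unclaimed_volume p)].

(** The form in which stability enters: up to a null set, positive unclaimed volume forces all
    centers to be sated. *)
Hypothesis P_stable :
  P (volume_in `]0, +oo] `\` sated_in setT) = 0.

Lemma measurable_volume_in A : measurable A -> measurable (volume_in A).
Proof.
by move=> mA; apply: (measurable_fun_unclaimed_volume fa) => //;
  exact: fa_measurable_dom fa.
Qed.

Lemma volume_in_ergodic A : measurable A ->
  P (volume_in A) = 0 \/ P (volume_in A) = 1.
Proof.
move=> mA; apply: P_erg => [|v]; first exact: measurable_volume_in.
apply/seteqP; split => p [Dp Ap]; split => //=.
- exact/(fa_translate_dom fa v).
- rewrite -(unclaimed_volume_translate fa v)//.
  exact/(fa_translate_dom fa v).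
- exact/(fa_translate_dom fa v).
- by rewrite (unclaimed_volume_translate fa).
Qed.

Lemma sated_in_ergodic : P (sated_in setT) = 0 \/ P (sated_in setT) = 1.
Proof.
apply: P_erg => [|v]; first exact: measurable_sated_in d_gt0 alpha_gt0 fa.
by apply/seteqP; split => p /(sated_in_translate fa v setT).
Qed.

Let mI : measurable (`]0, +oo] : set (\bar R)).
Proof. exact: emeasurable_itv. Qed.

(** The mean total unclaimed volume is 0 or infinite according to whether its share in the cube is 0
    or positive, and a nonnegative function vanishes almost everywhere iff its integral is 0. *)
Lemma volume_in_pos_eq0 : P (volume_in `]0, +oo]) = 0 <->
  M (alloc_graph Q [set Infty]) = 0.
Proof.
have mD := fa_measurable_dom fa.
have mV := measurable_fun_unclaimed_volume fa.
have absE : \int[P]_(p in D) `|unclaimed_volume p| =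
    \int[P]_(p in D) unclaimed_volume p.
  by apply: eq_integral => p _; rewrite gee0_abs// measure_ge0.
have VE : ~` [set p | D p -> unclaimed_volume p = 0] = volume_in `]0, +oo].
  apply/seteqP; split => p /=.
    move=> /not_implyP[Dp /eqP V0]; split => //=.
    by rewrite in_itv/= leey andbT lt_neqAle eq_sym V0 measure_ge0.
  by move=> [Dp]; rewrite /= in_itv /= => /andP[V0 _] /(_ Dp) VE; rewrite VE ltxx in V0.
have nP := negligibleP P (measurable_volume_in mI).
have aeP := ae_eq_integral_abs P mD mV; rewrite absE in aeP.
suff eqP0 : \int[P]_(p in D) unclaimed_volume p = 0 <->
    M (alloc_graph Q [set Infty]) = 0.
  apply: (iff_trans (iff_sym nP)); apply: iff_trans eqP0.
  by rewrite -VE; exact: iff_sym aeP.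
split => [V0|].
  apply: contrapT => /eqP u0.
  have := mean_unclaimed_volume_pinfty d_gt0 P_inv fa.
  by rewrite V0 lt_neqAle eq_sym u0 measure_ge0 => /(_ isT).
exact: (mean_unclaimed_volume_eq0 d_gt0 P_inv fa).
Qed.

Lemma volume_in_pos_sated :
  P (volume_in `]0, +oo]) = 1 -> P (sated_in setT) = 1.
Proof.
have mS := measurable_sated_in d_gt0 alpha_gt0 fa.
have mV := measurable_volume_in mI.
move=> /(probability_eq1P _ mV) V0; apply/probability_eq1P => //.
have nV : P.-negligible (~` volume_in `]0, +oo]).
  by apply/negligibleP => //; exact: measurableC.
have nVS : P.-negligible (volume_in `]0, +oo] `\` sated_in setT).
  by apply/negligibleP => //; exact: measurableD.
apply/negligibleP; first exact: measurableC.
apply: negligibleS (negligibleU nV nVS) => p nS.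
by have [Vp|Vp] := pselect (volume_in `]0, +oo] p); [right|left].
Qed.

(** Otherwise the volume is almost surely finite, and ergodicity applied to its sublevel sets bounds
    it almost surely by a constant, against its infinite mean. *)
Lemma volume_in_pinfty : 0 < M (alloc_graph Q [set Infty]) ->
  P (volume_in [set +oo]) = 1.
Proof.
move=> u0; have mD := fa_measurable_dom fa.
have mV := measurable_fun_unclaimed_volume fa.
have := mean_unclaimed_volume_pinfty d_gt0 P_inv fa u0.
have mle n : measurable (`]-oo, n%:R%:E] : set (\bar R)).
  exact: emeasurable_itv.
have [|//] := volume_in_ergodic (emeasurable_set1 +oo) => Voo.
(* If every integer level had probability 0, their union with the null event of infinite volume,
   which is [D], would be null. *)
have [n Vn] : exists n, P (volume_in `]-oo, n%:R%:E]) = 1.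
  apply: contrapT => /forallNP Vn.
  have : P D = 0.
    have -> : D = volume_in [set +oo] `|` \bigcup_n volume_in `]-oo, n%:R%:E].
      apply/seteqP; split => [p Dp|p [[]|[n _ []]]//].
      have [E|Vfin] := eqVneq (unclaimed_volume p) +oo; first by left.
      right; exists (Num.bound (fine (unclaimed_volume p))) => //.
      split => //=; rewrite in_itv /=.
      have V0 : 0 <= unclaimed_volume p by exact: measure_ge0.
      rewrite -[leLHS]fineK ?ge0_fin_numE ?ltey// lee_fin ltW//.
      by rewrite archi_boundP// fine_ge0.
    apply/negligibleP.
      apply: measurableU; first by apply: measurable_volume_in; exact: emeasurable_set1.
      by apply: bigcupT_measurable => n; exact: measurable_volume_in.
    apply: negligibleU.
      by apply/negligibleP => //; apply: measurable_volume_in; exact: emeasurable_set1.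
    apply: negligible_bigcup => n; apply/negligibleP; first exact: measurable_volume_in.
    by have [|/Vn] := volume_in_ergodic (mle n).
  by rewrite (P_dom fa) => /eqP; rewrite onee_eq0.
have : \int[P]_(p in D) unclaimed_volume p <= \int[P]_(p in D) n%:R%:E.
  apply: ae_ge0_le_integral => //.
  move/(probability_eq1P _ (measurable_volume_in (mle n))) : Vn => Vn.
  exists (~` volume_in `]-oo, n%:R%:E]); split => //.
    by apply: measurableC; exact: measurable_volume_in.
  by move=> p /= H [Dp pn]; apply: H => _; move: pn; rewrite /= in_itv.
by rewrite integral_cst// [X in _ * X](P_dom fa) mule1 => le => oo; move: le; rewrite oo leye_eq.
Qed.

Lemma subcritical : (lambda * alpha < 1)%R ->
  P (sated_in setT) = 1 /\ P (volume_in [set +oo]) = 1.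
Proof.
move=> la; have := unit_volume_split fa.
have := mean_claimed_le d_gt0 alpha_gt0 P_inv P_int fa.
have [u0|u0] := eqVneq (M (alloc_graph Q [set Infty])) 0.
  by rewrite u0 adde0 => /[swap] ->; rewrite lee_fin leNgt la.
move=> _ _; split.
  apply: volume_in_pos_sated; have [/volume_in_pos_eq0|//] := volume_in_ergodic mI.
  by move/eqP; rewrite (negbTE u0).
by apply: volume_in_pinfty; rewrite lt_neqAle eq_sym u0 measure_ge0.
Qed.

(** Positive unclaimed volume would make all centers sated, hence the claimed mean 1 and the
    unclaimed mean 0. So nothing is unclaimed, the claimed mean is 1, and the equality case yields
    satedness. *)
Lemma critical : (lambda * alpha = 1)%R ->
  P (sated_in setT) = 1 /\ P (volume_in `]0, +oo]) = 0.
Proof.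
move=> la; have split1 := unit_volume_split fa.
have V0 : P (volume_in `]0, +oo]) = 0.
  have [//|V1] := volume_in_ergodic mI.
  have := mean_claimed_sated d_gt0 alpha_gt0 P_inv P_int fa (volume_in_pos_sated V1).
  move=> m1; apply/volume_in_pos_eq0.
  have := congr1 (fun x => x - 1) split1; rewrite m1 la addeC addeK// => ->.
  by rewrite subee.
split=> //; apply: (sated_mean_claimed d_gt0 alpha_gt0 P_inv P_int fa).
by move: split1; rewrite (volume_in_pos_eq0.1 V0) adde0 la.
Qed.

(** Universal satedness would push the claimed mean above 1; without it, stability excludes
    unclaimed volume. *)
Lemma supercritical : (1 < lambda * alpha)%R ->
  P (sated_in setT) = 0 /\ P (volume_in `]0, +oo]) = 0.
Proof.
move=> la; have S0 : P (sated_in setT) = 0.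
  have [//|S1] := sated_in_ergodic.
  have := mean_claimed_sated d_gt0 alpha_gt0 P_inv P_int fa S1 => m1.
  have := unit_volume_split fa; rewrite m1 => E.
  have : (lambda * alpha)%:E <= 1 by rewrite -E leeDl// measure_ge0.
  by rewrite lee_fin leNgt la.
split => //; have [//|/volume_in_pos_sated] := volume_in_ergodic mI.
by rewrite S0 => /esym/eqP; rewrite onee_eq0.
Qed.

End ergodicity.

(** * Transfer to the underlying probability space *)

Theorem theorem4 (R : realType) (d : nat) (d_ge1 : (1 <= d)%N)
    (dO : measure_display) (Omega : measurableType dO)
    (Pr : probability Omega R) (Pi : {mfun Omega >-> point_measure R d})
    (Pi_inv : translation_invariant (distribution Pr Pi))
    (Pi_erg : ergodic (distribution Pr Pi))
    (lambda : R) (lambda_gt0 : (0 < lambda)%R)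
    (Pi_int : intensity (distribution Pr Pi) = lambda%:E)
    (alpha : R) (alpha_gt0 : (0 < alpha)%R)
    (D : set (point_measure R d))
    (Psi : point_measure R d -> 'rV[R]_d -> alloc_value R d)
    (Psi_stable : stable_factor_allocation Pr Pi alpha D Psi) :
  [/\ (lambda * alpha < 1)%R ->
        {ae Pr, forall w,
          (forall xi, pm_support (Pi w) xi -> sated alpha (Psi (Pi w)) xi) /\
          lebesgue_rV R d (unclaimed_sites (Psi (Pi w))) = +oo},
      (lambda * alpha = 1)%R ->
        {ae Pr, forall w,
          (forall xi, pm_support (Pi w) xi -> sated alpha (Psi (Pi w)) xi) /\
          {ae lebesgue_rV R d, forall x,
            claimed (pm_support (Pi w)) (Psi (Pi w)) x}} &
      (1 < lambda * alpha)%R ->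
        {ae Pr, forall w,
          ~ (forall xi, pm_support (Pi w) xi ->
               sated alpha (Psi (Pi w)) xi) /\
          {ae lebesgue_rV R d, forall x,
            claimed (pm_support (Pi w)) (Psi (Pi w)) x}}].
Proof.
have [fa st] := Psi_stable.
set P := distribution Pr Pi in Pi_inv Pi_erg Pi_int fa.
have mS := measurable_sated_in d_ge1 alpha_gt0 fa.
have mV := @measurable_volume_in _ _ _ _ _ _ fa.
have mpos : measurable (`]0, +oo] : set (\bar R)) by exact: emeasurable_itv.
have aeP A : measurable A -> P A = 1 -> {ae Pr, forall w, A (Pi w)}.
  move=> mA /(probability_eq1P _ mA) A0.
  exists (Pi @^-1` (~` A)); split => //.
  exact: measurable_preimage (measurable_funP Pi) (measurableC mA).
have ae_not A : measurable A -> P A = 0 -> {ae Pr, forall w, ~ A (Pi w)}.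
  move=> mA A0; apply: (aeP (~` A)); first exact: measurableC.
  by apply/probability_eq1P; [exact: measurableC|rewrite setCK].
(* Positive unclaimed volume provides an actual unclaimed site, so an unsated center would
   contradict stability; such outcomes lie in the null set where stability fails. *)
have stP : P (volume_in D Psi `]0, +oo] `\` sated_in alpha D Psi setT) = 0.
  have mVS := measurableD (mV _ mpos) mS.
  rewrite /P /distribution /pushforward; apply/negligibleP.
    exact: measurable_preimage (measurable_funP Pi) mVS.
  apply: negligibleS st => w /= [[Dw]]; rewrite /= in_itv /= => /andP[V0 _] nS.
  move=> stw; apply: nS; split => // xi _ pxi.
  have [x ux] : unclaimed_sites (Psi (Pi w)) !=set0.
    by apply/set0P/eqP => U0; rewrite /unclaimed_volume U0 measure0 ltxx in V0.
  exact: stable_unclaimed_sated stw ux pxi.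
have claimed_ae w : D (Pi w) -> ~ volume_in D Psi `]0, +oo] (Pi w) ->
    {ae lebesgue_rV R d, forall x, claimed (pm_support (Pi w)) (Psi (Pi w)) x}.
  move=> Dw nV; have [mpsi psiX De _] := fa_allocation fa Dw.
  have nU : (lebesgue_rV R d).-negligible (unclaimed_sites (Psi (Pi w))).
    apply/negligibleP; first exact: (measurable_unclaimed_sites fa).
    apply/eqP; rewrite eq_le measure_ge0 andbT leNgt; apply/negP => V0.
    by apply: nV; split => //=; rewrite in_itv /= V0 leey.
  have nD : (lebesgue_rV R d).-negligible (Psi (Pi w) @^-1` [set Delta]).
    apply/negligibleP => //.
    exact: measurable_preimage mpsi (@measurable_Delta R d).
  apply: negligibleS (negligibleU nU nD) => x /= nc.
  case E : (Psi (Pi w) x) => [xi| |]; [|by left|by right].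
  by case: nc; exists xi => //; exact: psiX E.
have aeD : {ae Pr, forall w, D (Pi w)}.
  exact: aeP (fa_measurable_dom fa) (P_dom fa).
split=> la.
- have [S1 V1] := subcritical d_ge1 alpha_gt0 Pi_inv Pi_int fa Pi_erg stP la.
  have aeS := aeP _ mS S1; have aeV := aeP _ (mV _ (emeasurable_set1 +oo)) V1.
  by apply: filterS2 aeS aeV => w [_ sat] [_ Voo]; split => // xi; exact: sat.
- have [S1 V0] := critical d_ge1 alpha_gt0 Pi_inv Pi_int fa Pi_erg stP la.
  have aeS := aeP _ mS S1; have aeV := ae_not _ (mV _ mpos) V0.
  apply: filterS2 aeS aeV => w [Dw sat] nV; split; last exact: claimed_ae.
  by move=> xi; exact: sat.
- have [S0 V0] := supercritical d_ge1 alpha_gt0 Pi_inv Pi_int fa Pi_erg stP la.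
  have aeS := ae_not _ mS S0; have aeV := ae_not _ (mV _ mpos) V0.
  (* Failure of [sated_in] yields an unsated center only when [Pi w] lies in [D], hence the third
     almost sure event. *)
  apply: filterS3 aeD aeS aeV => w Dw nS nV; split; last exact: claimed_ae.
  by move=> sat; apply: nS; split => // xi _; exact: sat.
Qed.
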